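(* Let $T:\mathbb T_L\to\mathbb T_{L'}$ be a translation from a language $L$ with value set $\mathbf V$ into a language $L'$ with value set $\mathbf V'$, where $\mathbf V\cap\mathbf V'=\emptyset$, and suppose $T$ is valid up to an equivalence relation $\sim$ (on a set containing $\mathbf V\cup\mathbf V'$). Then there is an equivalence relation $\approx$ on $\mathbf V\cup\mathbf V'$, contained in $\sim$, such that $T$ is valid up to $\approx$ and: (1) the restriction of $\approx$ to $\mathbf V$ is the largest 1-hole congruence for $L$ contained in $\sim$; (2) the set $\mathbf W:=\{v'\in\mathbf V'\mid\exists v\in\mathbf V.\ v'\approx v\}$ is closed under $T(L)$; and (3) the restriction of $\approx$ to $\mathbf W$ is the largest 1-hole congruence for $T(L)$ on $\mathbf W$ that is contained in $\sim$.
   Context: Fix a set $\mathcal V$ of variables. A language $L$ consists of a set $\mathbb T_L$ of expressions and a semantic map $[\![\cdot]\!]_L:\mathbb T_L\to((\mathcal V\to\mathbf V)\to\mathbf V)$; maps $\rho:\mathcal V\to\mathbf V$ are valuations. A translation is any map $T:\mathbb T_L\to\mathbb T_{L'}$. A semantic translation is a relation $R\subseteq\mathbf V'\times\mathbf V$ such that every $v\in\mathbf V$ has some $v'\in\mathbf V'$ with $v'Rv$; for valuations, $\eta R\rho$ means $\eta(X)R\rho(X)$ for all $X$. $T$ is correct w.r.t. $R$ if $[\![T(E)]\!]_{L'}(\eta)\,R\,[\![E]\!]_L(\rho)$ for all $E\in\mathbb T_L$ and all $\eta:\mathcal V\to\mathbf V'$, $\rho:\mathcal V\to\mathbf V$ with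 $\eta R\rho$. $T$ is valid up to a preorder (or equivalence) $\precsim$ if it is correct w.r.t. some semantic translation $R\subseteq\,\precsim$. An equivalence $\approx$ on $\mathbf V$ is a 1-hole congruence for $L$ if $[\![E]\!]_L(\nu)\approx[\![E]\!]_L(\rho)$ for all $E\in\mathbb T_L$ and all valuations $\nu,\rho:\mathcal V\to\mathbf V$ such that for some $X$, $\nu(X)\approx\rho(X)$ and $\nu(Y)=\rho(Y)$ for all $Y\ne X$ (the largest 1-hole congruence for $L$ contained in a given equivalence exists, since 1-hole congruences are closed under the join of equivalences). A set $\mathbf W\subseteq\mathbf V'$ is closed under $T(L)$ if $[\![T(E)]\!]_{L'}(\eta)\in\mathbf W$ for all $E\in\mathbb T_L$ and $\eta:\mathcal V\to\mathbf W$. An equivalence $\approx$ on $\mathbf W$ is a 1-hole congruence for $T(L)$ on $\mathbf W$ if $[\![T(E)]\!]_{L'}(\theta)\approx[\![T(E)]\!]_{L'}(\eta)$ for all $E\in\mathbb T_L$ and all $\theta,\eta:\mathcal V\to\mathbf W$ that differ in at most one variable $X$, with $\theta(X)\approx\eta(X)$. *)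

(* Defs.v *)
From mathcomp Require Import all_boot.
From mathcomp Require Import boolp classical_sets.
From Corelib Require Import Relation_Definitions RelationClasses.

Set Implicit Arguments.
Unset Strict Implicit.
Unset Printing Implicit Defensive.

Local Open Scope classical_set_scope.

(* All value sets are subsets of one ambient type [U].  A relation on a set
   [A : set U] is a [relation U] whose graph lies in [A] x [A], so that
   relations on [A] are equal as soon as they agree on [A]. *)
Definition relation_on (U : Type) (A : set U) (r : relation U) : Prop :=
  forall x y, r x y -> A x /\ A y.

Definition equivalence_on (U : Type) (A : set U) (r : relation U) : Prop :=
  [/\ relation_on A r,
      forall x, A x -> r x x,
      forall x y, r x y -> r y x
    & forall x y z, r x y -> r y z -> r x z].

Definition restriction (U : Type) (A : set U) (r : relation U) : relation U :=
  fun x y => [/\ A x, A y & r x y].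

Definition largest (U : Type) (P : relation U -> Prop) (r : relation U) : Prop :=
  P r /\ forall s, P s -> subrelation s r.

Record language (Var U : Type) (V : set U) := Language {
  expr : Type;
  sem : expr -> (Var -> V) -> V
}.
Arguments language : clear implicits.
Arguments Language {Var U V}.
Arguments expr {Var U V}.
Arguments sem {Var U V} l E rho.

Definition translation (Var U : Type) (V V' : set U)
    (L : language Var U V) (L' : language Var U V') : Type :=
  expr L -> expr L'.

Definition semantic_translation (U : Type) (V V' : set U)
    (R : V' -> V -> Prop) : Prop :=
  forall v, exists v', R v' v.

Definition correct_wrt (Var U : Type) (V V' : set U)
    (L : language Var U V) (L' : language Var U V') (T : translation L L')
    (R : V' -> V -> Prop) : Prop :=
  forall (E : expr L) (eta : Var -> V') (rho : Var -> V),
    (forall X, R (eta X) (rho X)) -> R (sem L' (T E) eta) (sem L E rho).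

Definition valid_upto (Var U : Type) (V V' : set U)
    (L : language Var U V) (L' : language Var U V') (T : translation L L')
    (r : relation U) : Prop :=
  exists R : V' -> V -> Prop,
    [/\ semantic_translation R,
        forall v' v, R v' v -> r (val v') (val v)
      & correct_wrt T R].

Definition one_hole_congruence (Var U : Type) (V : set U)
    (L : language Var U V) (r : relation U) : Prop :=
  equivalence_on V r /\
  forall (E : expr L) (nu rho : Var -> V) (X : Var),
    r (val (nu X)) (val (rho X)) ->
    (forall Y, Y <> X -> nu Y = rho Y) ->
    r (val (sem L E nu)) (val (sem L E rho)).

(* In the next two definitions a valuation into [W], a subset of [V'], is a
   valuation into [V'] all of whose values lie in [W]. *)
Definition closed_under (Var U : Type) (V V' : set U)
    (L : language Var U V) (L' : language Var U V') (T : translation L L')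
    (W : set U) : Prop :=
  forall (E : expr L) (eta : Var -> V'),
    (forall X, W (val (eta X))) -> W (val (sem L' (T E) eta)).

Definition one_hole_congruence_on (Var U : Type) (V V' : set U)
    (L : language Var U V) (L' : language Var U V') (T : translation L L')
    (W : set U) (r : relation U) : Prop :=
  equivalence_on W r /\
  forall (E : expr L) (theta eta : Var -> V') (X : Var),
    (forall Y, W (val (theta Y))) -> (forall Y, W (val (eta Y))) ->
    r (val (theta X)) (val (eta X)) ->
    (forall Y, Y <> X -> theta Y = eta Y) ->
    r (val (sem L' (T E) theta)) (val (sem L' (T E) eta)).

(* Main.v *)
Require Import Defs.
From mathcomp Require Import all_boot.
From mathcomp Require Import boolp classical_sets.
From Corelib Require Import Relation_Definitions RelationClasses.
From Stdlib Require Import Relation_Operators.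

(** On [V], approx is the largest 1-hole congruence C for L contained in ~.
    Let R be the semantic translation underlying T.  Pulling back along R a
    1-hole congruence of T(L) on the domain of R gives a symmetric reflexive
    relation on V preserved by all 1-hole contexts of L, whose transitive
    closure is a 1-hole congruence, so the pullback lies in C.  For the
    identity this says that all R-images of one v' are C-equivalent; hence
    gluing each v' in the domain of R to the C-class of its R-images gives an
    equivalence, and each 1-hole congruence of T(L) lies in it. *)

Local Open Scope classical_set_scope.

Definition update {Var A : Type} (rho : Var -> A) (X : Var) (a : A) : Var -> A :=
  fun Y => if pselect (Y = X) then a else rho Y.

Lemma update_same {Var A : Type} (rho : Var -> A) X a : update rho X a X = a.
Proof. by rewrite /update; case: pselect. Qed.

Lemma update_other {Var A : Type} (rho : Var -> A) X a Y :
  Y <> X -> update rho X a Y = rho Y.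
Proof. by rewrite /update; case: pselect. Qed.

Lemma eq_update {Var A : Type} {nu rho : Var -> A} {X} :
  (forall Y, Y <> X -> nu Y = rho Y) -> rho = update nu X (rho X).
Proof.
move=> e; apply: funext => Y; rewrite /update.
by case: pselect => /= [->|/e ->].
Qed.

Lemma update_id {Var A : Type} (rho : Var -> A) X : update rho X (rho X) = rho.
Proof. by symmetry; apply: eq_update. Qed.

(** Transitivity is left out on purpose: a pullback along a semantic translation need not be
    transitive. A pair of valuations differing in one variable is encoded as two updates of the same
    valuation. *)
Definition one_hole_compatible {Var U : Type} {V : set U}
    (L : language Var U V) (sim : relation U) (r : relation V) : Prop :=
  [/\ forall u, r u u,
      forall u w, r u w -> r w u,
      forall u w, r u w -> sim (val u) (val w)
    & forall E rho X u w, r u w ->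
        r (sem L E (update rho X u)) (sem L E (update rho X w))].

(** Chains of steps, each step taken in some compatible relation: the join of all of them, and hence
    the largest 1-hole congruence contained in [sim]. *)
Definition one_hole_closure {Var U : Type} {V : set U}
    (L : language Var U V) (sim : relation U) : relation V :=
  clos_trans V (fun u w => exists2 r, one_hole_compatible L sim r & r u w).

Lemma sub_one_hole_closure {Var U : Type} {V : set U} {L : language Var U V}
    {sim : relation U} {r : relation V} :
  one_hole_compatible L sim r -> subrelation r (one_hole_closure L sim).
Proof. by move=> rc u w ruw; apply: t_step; exists r. Qed.

(** A context maps a chain link by link to a chain, reversing a chain reverses its links, and
    transitivity of [sim] collapses a chain to one pair. Reflexivity comes from equality, itself
    compatible because [sim] is reflexive on [V]. *)
Lemma one_hole_closure_compatible {Var U : Type} {V D : set U}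
    {L : language Var U V} {sim : relation U} :
  V `<=` D -> equivalence_on D sim ->
  one_hole_compatible L sim (one_hole_closure L sim).
Proof.
move=> VD [_ simxx simC simT]; split.
- move=> u; apply: t_step; exists eq => //; split=> //.
  + by move=> {}u _ <-; apply: simxx; apply: VD; exact: set_valP.
  + by move=> E rho X {}u _ <-.
- move=> u w; elim=> {u w} [u w [r rc ruw]|u v w _ IHuv _ IHvw].
    by apply: t_step; exists r => //; case: rc => _ rC _ _; exact: rC.
  exact: t_trans IHvw IHuv.
- move=> u w; elim=> {u w} [u w [r [_ _ rs _] /rs]//|u v w _ IHuv _ IHvw].
  exact: simT IHuv IHvw.
- move=> E rho X u w; elim=> {u w} [u w [r rc ruw]|u v w _ IHuv _ IHvw].
    by apply: t_step; exists r => //; case: rc => _ _ _; exact.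
  exact: t_trans IHuv IHvw.
Qed.

Lemma one_hole_congruence_compatible {Var U : Type} {V : set U}
    {L : language Var U V} {sim r : relation U} :
  one_hole_congruence L r -> subrelation r sim ->
  one_hole_compatible L sim (fun u w => r (val u) (val w)).
Proof.
move=> [[_ rxx rC _] rL] rsim; split.
- by move=> u; apply: rxx; exact: set_valP.
- by move=> u w /rC.
- by move=> u w /rsim.
- move=> E rho X u w ruw; apply: (rL E _ _ X); first by rewrite !update_same.
  by move=> Y YX; rewrite !update_other.
Qed.

Definition pullback {A B : Type} (R : A -> B -> Prop) (s : relation A) :
    relation B :=
  fun u w => exists u' w', [/\ R u' u, R w' w & s u' w'].

(** Totality of [R] supplies preimages for the values of the other variables, and correctness then
    carries a context of [L] over to its translation. Containment in [sim] follows the path from [u]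
    to [u'] to [w'] to [w]. Reflexivity and the context condition are asked of [s] only on the
    domain of [R], so that relations on [W] qualify. *)
Lemma pullback_compatible {Var U : Type} {V V' D : set U}
    {L : language Var U V} {L' : language Var U V'} {T : translation L L'}
    {sim : relation U} {R : V' -> V -> Prop} {s : relation V'} :
  equivalence_on D sim ->
  semantic_translation R -> (forall v' v, R v' v -> sim (val v') (val v)) ->
  correct_wrt T R ->
  (forall v' v, R v' v -> s v' v') ->
  (forall v' w', s v' w' -> s w' v') ->
  (forall v' w', s v' w' -> sim (val v') (val w')) ->
  (forall E (eta : Var -> V') X u' w',
      (forall Y, exists v, R (eta Y) v) ->
      (exists u, R u' u) -> (exists w, R w' w) -> s u' w' ->
      s (sem L' (T E) (update eta X u')) (sem L' (T E) (update eta X w'))) ->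
  one_hole_compatible L sim (pullback R s).
Proof.
move=> [_ _ simC simT] Rtot Rsim TR sxx sC ssim sT; split.
- by move=> u; have [u' Ru] := Rtot u; exists u', u'; split=> //; exact: sxx Ru.
- by move=> u w [u' [w' [Ru Rw /sC suw]]]; exists w', u'.
- move=> u w [u' [w' [/Rsim Ru /Rsim Rw /ssim suw]]].
  exact: simT (simT _ _ _ (simC _ _ Ru) suw) Rw.
- move=> E rho X u w [u' [w' [Ru Rw suw]]].
  have [eta Reta] := choice (fun Y => Rtot (rho Y)).
  exists (sem L' (T E) (update eta X u')), (sem L' (T E) (update eta X w')).
  split.
  + by apply: TR => Y; rewrite /update; case: pselect => /=.
  + by apply: TR => Y; rewrite /update; case: pselect => /=.
  + apply: sT => //; [|by exists u|by exists w].
    by move=> Y; exists (rho Y).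
Qed.

(** The representatives of [x] in [V]; an element of [V] represents itself, so that [glue] treats
    both value sets alike. *)
Definition linked {U : Type} {V V' : set U} (R : V' -> V -> Prop) (x : U)
    (v : V) : Prop :=
  x = val v \/ exists2 v', x = val v' & R v' v.

(* The elements of [V'] outside the domain of [R] are only related to
   themselves. *)
Definition glue {U : Type} {V V' : set U} (R : V' -> V -> Prop)
    (C : relation V) : relation U :=
  fun x y => ((V `|` V') x /\ x = y) \/
             exists u w, [/\ linked R x u, linked R y w & C u w].

Theorem theorem4 (Var U : Type) (V V' D : set U)
    (L : language Var U V) (L' : language Var U V') (T : translation L L')
    (sim : relation U)
    (disjVV' : V `&` V' = set0)
    (subD : V `|` V' `<=` D)
    (sim_equiv : equivalence_on D sim)
    (T_valid : valid_upto T sim) :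
  exists approx : relation U,
    [/\ equivalence_on (V `|` V') approx,
        subrelation approx sim,
        valid_upto T approx
      & let W := [set v' | V' v' /\ exists v, V v /\ approx v' v] in
        [/\ largest (fun r => one_hole_congruence L r /\ subrelation r sim)
              (restriction V approx),
            closed_under T W
          & largest (fun r => one_hole_congruence_on T W r /\ subrelation r sim)
              (restriction W approx)]].
Proof.
have [R [Rtot Rsim TR]] := T_valid.
have [simD simxx simC simT] := sim_equiv.
have VD : V `<=` D by move=> x Vx; apply: subD; left.
have V'D : V' `<=` D by move=> x Vx; apply: subD; right.
have VV'F x : V x -> V' x -> False.
  by move=> Vx V'x; have : (V `&` V') x by []; rewrite disjVV'.
pose C := one_hole_closure L sim.
have CT u v w : C u v -> C v w -> C u w by exact: t_trans.
have Cc : one_hole_compatible L sim C := one_hole_closure_compatible VD sim_equiv.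
have [Cxx CC Csim CL] := Cc.
have RC v' u w : R v' u -> R v' w -> C u w.
  move=> Ru Rw.
  have eqc : one_hole_compatible L sim (pullback R eq).
    apply: (pullback_compatible sim_equiv Rtot Rsim TR) => //.
    - by move=> a _ <-; apply/simxx/V'D/set_valP.
    - by move=> E eta X u' _ _ _ _ <-.
  by apply: (sub_one_hole_closure eqc); exists v', v'.
have linkR v' v : linked R (val v') v -> R v' v.
  case=> [e|[w' /val_inj <- //]].
  by case: (VV'F (val v)); [exact: set_valP | rewrite -e; exact: set_valP].
have linkV (v w : V) : linked R (val v) w -> v = w.
  case=> [/val_inj //|[w' e _]].
  by case: (VV'F (val v)); [exact: set_valP | rewrite e; exact: set_valP].
(* Representatives are unique up to [C]; this is what makes [approx] transitive. *)
have linkC x u w : linked R x u -> linked R x w -> C u w.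
  case=> [-> /linkV -> //|[v' -> Ru] /linkR]; exact: RC.
have link_sim x u : linked R x u -> sim x (val u).
  case=> [->|[v' -> /Rsim //]]; exact/simxx/VD/set_valP.
have link_dom x u : linked R x u -> (V `|` V') x.
  by case=> [->|[v' -> _]]; [left|right]; exact: set_valP.
pose approx := glue R C.
have approxV u w : approx (val u) (val w) <-> C u w.
  split=> [[[_ /val_inj -> //]|[a [b [/linkV -> /linkV -> //]]]]|Cuw].
  by right; exists u, w; split=> //; left.
(* By [RC] it does not matter which images are taken, so questions about [approx] on the domain of
   [R] become questions about [C]. *)
have approxR u' w' u w : R u' u -> R w' w ->
    approx (val u') (val w') <-> C u w.
  move=> Ru Rw; split=> [[[_ /val_inj e]|[a [b [/linkR Ra /linkR Rb Cab]]]]|Cuw].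
  - by apply: (RC u') => //; rewrite e.
  - exact: CT (RC _ _ _ Ru Ra) (CT _ _ _ Cab (RC _ _ _ Rb Rw)).
  - by right; exists u, w; split=> //; right; [exists u'|exists w'].
have approx_sim : subrelation approx sim.
  move=> x y [[/subD Dx <-]|[u [w [/link_sim xu /link_sim yw /Csim uw]]]].
    exact: simxx.
  exact: simT (simT _ _ _ xu uw) (simC _ _ yw).
have approx_eq : equivalence_on (V `|` V') approx.
  split.
  - by move=> x y [[Vx <-]|[u [w [/link_dom ? /link_dom ? _]]]].
  - by move=> x Vx; left.
  - move=> x y [[Vx <-]|[u [w [xu yw Cuw]]]]; first by left.
    by right; exists w, u; split=> //; exact: CC.
  - move=> x y z [[_ <- //]|[u [w [xu yw Cuw]]]].
    case=> [[_ <-]|[a [b [ya zb Cab]]]]; first by right; exists u, w.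
    right; exists u, b; split=> //.
    exact: CT Cuw (CT _ _ _ (linkC _ _ _ yw ya) Cab).
have [_ apxx apC apT] := approx_eq.
exists approx; split=> //.
  (* The original [R] still serves: [v] represents both [v'] and itself. *)
  exists R; split=> // v' v Rv; right; exists v, v.
  by split=> //; [right; exists v'|left].
move=> W.
(* [W] is exactly the domain of [R]: disjointness rules out that [v'] is approx-related to an
   element of [V] by being equal to it. *)
have WP (v' : V') : W (val v') <-> exists v, R v' v.
  split=> [[_ [x [Vx [[_ e]|[u [_ [/linkR Ru _ _]]]]]]]|[v Rv]].
  - by case: (VV'F x) => //; rewrite -e; exact: set_valP.
  - by exists u.
  - split; first exact: set_valP.
    exists (val v); split; first exact: set_valP.
    by right; exists v, v; split=> //; [right; exists v'|left].
have liftV x (Vx : V x) : exists v : V, val v = x.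
  by exists (exist _ x (mem_set Vx)).
have liftW x (Wx : W x) : exists2 v' : V', val v' = x & exists v, R v' v.
  have [V'x _] := Wx; pose v' : V' := exist _ x (mem_set V'x).
  by exists v' => //; apply/WP.
have rest_eq A : A `<=` V `|` V' -> equivalence_on A (restriction A approx).
  move=> AV; split.
  - by move=> x y [].
  - by move=> x Ax; split=> //; exact/apxx/AV.
  - by move=> x y [Ax Ay /apC].
  - by move=> x y z [Ax Ay xy] [_ Az yz]; split=> //; exact: apT yz.
have rest_sim A : subrelation (restriction A approx) sim.
  by move=> x y [_ _ /approx_sim].
split.
- split; first split=> //.
  + split; first by apply: rest_eq => x; left.
    move=> E nu rho X [_ _ /approxV CX] e.
    split; [exact: set_valP|exact: set_valP|apply/approxV].
    by rewrite (eq_update e) -{1}(update_id nu X); exact: CL.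
  + move=> s [sc ssim] x y sxy; have [[sV _ _ _] _] := sc.
    have [Vx Vy] := sV _ _ sxy; split=> //.
    have [u eu] := liftV x Vx; have [w ew] := liftV y Vy.
    rewrite -eu -ew in sxy *; apply/approxV.
    exact: (sub_one_hole_closure (one_hole_congruence_compatible sc ssim)).
- move=> E eta Weta; apply/WP.
  have [rho Rrho] := choice (fun Y => (WP (eta Y)).1 (Weta Y)).
  by exists (sem L E rho); exact: TR.
- split; first split=> //.
  + split; first by apply: rest_eq => x [V'x _]; right.
    move=> E theta eta X Wt We [_ _ apX] e.
    have [rho Rrho] := choice (fun Y => (WP (theta Y)).1 (Wt Y)).
    have [w Rw] := (WP (eta X)).1 (We X).
    have Rt := TR E _ _ Rrho.
    (* Images for [eta] are not chosen afresh, since they could differ from [rho] at every variable.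
       Off [X] those of [theta] are reused, which leaves a single hole for [CL]. *)
    have Re : R (sem L' (T E) eta) (sem L E (update rho X w)).
      apply: TR => Y; rewrite /update; case: pselect => /= [->//|/e <-].
      exact: Rrho.
    split; [by apply/WP; eexists; exact: Rt|by apply/WP; eexists; exact: Re|].
    apply/(approxR _ _ _ _ Rt Re); rewrite -{1}(update_id rho X); apply: CL.
    exact/(approxR _ _ _ _ (Rrho X) Rw).
  + move=> s [[[sW sxx sC _] sT] ssim] x y sxy.
    have [Wx Wy] := sW _ _ sxy; split=> //.
    have [x' ex [u Ru]] := liftW x Wx; have [y' ey [w Rw]] := liftW y Wy.
    rewrite -ex -ey in sxy *; apply/(approxR _ _ _ _ Ru Rw).
    pose s' : relation V' := fun a b => s (val a) (val b).
    (* Once the pullback of [s] lies in [C], the pair [x'], [y'] witnesses that the images [u] and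
       [w] are [C]-related. *)
    have sc : one_hole_compatible L sim (pullback R s').
      apply: (pullback_compatible sim_equiv Rtot Rsim TR).
      * by move=> v' v Rv; apply/sxx/WP; exists v.
      * by move=> v' w' /sC.
      * by move=> v' w' /ssim.
      * move=> E eta X u' w' dometa domu domw suw.
        apply: (sT E _ _ X).
        -- by move=> Y; apply/WP; rewrite /update; case: pselect => /=.
        -- by move=> Y; apply/WP; rewrite /update; case: pselect => /=.
        -- by rewrite !update_same.
        -- by move=> Y YX; rewrite !update_other.
    by apply: (sub_one_hole_closure sc); exists x', y'.
Qed.
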